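(* Let $\mathcal H$ be a real Hilbert space and let $f:\mathcal H\to\mathbb R\cup\{+\infty\}$ be proper, lower semicontinuous and convex with $\mathcal S:=\operatorname{argmin}_{\mathcal H}f\neq\emptyset$. Let $p\ge1$ and assume $f\in\mathrm{EB}^p(\mathcal S)$. Let $x^\star=\operatorname{proj}_{\mathcal S}(0)$ and, for $\varepsilon>0$, let $x_\varepsilon$ be the unique minimizer of $f_\varepsilon(x)=f(x)+\frac\varepsilon2\|x\|^2$. Then there exist $C_0,\varepsilon^\star>0$ such that $$\|x_\varepsilon-x^\star\|\le C_0\,\varepsilon^{\frac1{2p}},\quad\forall\varepsilon\in(0,\varepsilon^\star].$$ Consequently, there exists $C>0$ such that $$\|x^\star\|^2-\|x_\varepsilon\|^2\le C\,\varepsilon^{\frac1{2p}},\quad\forall\varepsilon\in(0,\varepsilon^\star].$$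
   Context: $f\in\mathrm{EB}^p(\mathcal S)$ (Hölderian error bound with exponent $p\ge1$) means: there exist $\gamma>0$ and $r>\min f$ such that $f(x)-\min f\ge\gamma\operatorname{dist}(x,\mathcal S)^p$ for all $x\in\mathcal H$ with $\min f\le f(x)\le r$. $\operatorname{proj}_{\mathcal S}$ is the metric projection onto the closed convex set $\mathcal S$. *)

(* Defs.v *)
From HB Require Import structures.
From mathcomp Require Import all_boot all_order all_algebra.
From mathcomp Require Import sesquilinear.
From mathcomp Require Import all_classical all_reals all_analysis.

Set Implicit Arguments.
Unset Strict Implicit.
Unset Printing Implicit Defensive.

Import Order.TTheory GRing.Theory Num.Theory.
Import numFieldNormedType.Exports.

Local Open Scope classical_set_scope.
Local Open Scope ring_scope.

Section Defs.
Context {R : realType} {H : completeNormedModType R}.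
Implicit Types (f : H -> \bar R) (A : set H).

(* A complete normed space is a Hilbert space when its norm comes from the
   inner product. *)
Definition induces_norm (dot : {dot H for idfun}) : Prop :=
  forall x : H, `|x| ^+ 2 = dot x x.

Definition proper_function f : Prop :=
  (forall x, f x != -oo%E) /\ (exists x, f x != +oo%E).

(* Since 0 * +oo = 0 in \bar R, the cases t = 0 and t = 1 are harmless. *)
Definition econvex_function f : Prop :=
  forall (x y : H) (t : R), 0 <= t <= 1 ->
    (f (t *: x + (1 - t) *: y)%R <= t%:E * f x + (1 - t)%:E * f y)%E.

Definition argmin f : set H := [set x | forall y, (f x <= f y)%E].

(* The infimum of f, equal to min f as soon as argmin f is nonempty. *)
Definition minval f : \bar R := ereal_inf (range f).

(* Hölderian error bound of exponent p with respect to A. *)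
Definition EB (p : R) A f : Prop :=
  exists gamma r : R, [/\ 0 < gamma, (minval f < r%:E)%E &
    forall x : H, (minval f <= f x)%E -> (f x <= r%:E)%E ->
      (gamma%:E * (edist_inf A x) `^ p <= f x - minval f)%E].

(* The element of a singleton; the junk value 0 if A is not a singleton. *)
Definition the_element A : H := xget 0 [set x | A = [set x]].

Definition metric_proj A (x : H) : H :=
  the_element [set p | A p /\ forall q, A q -> `|x - p| <= `|x - q|].

Definition tikhonov f (eps : R) : H -> \bar R :=
  fun x => (f x + (eps / 2 * `|x| ^+ 2)%:E)%E.

Definition tikhonov_min f (eps : R) : H :=
  the_element (argmin (tikhonov f eps)).

End Defs.

(* Main.v *)
Require Import Defs.
From HB Require Import structures.
From mathcomp Require Import all_boot all_order all_algebra.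
From mathcomp Require Import sesquilinear.
From mathcomp Require Import all_classical all_reals all_analysis.
From mathcomp Require Import ring lra.

Set Implicit Arguments.
Unset Strict Implicit.
Unset Printing Implicit Defensive.

Import Order.TTheory GRing.Theory Num.Theory.
Import numFieldNormedType.Exports.

Local Open Scope classical_set_scope.
Local Open Scope ring_scope.

(* Comparing the values of f_eps at x_eps and at x* gives |x_eps| <= |x*| and
   f(x_eps) - min f = O(eps), so the error bound provides a minimizer s of f
   with |x_eps - s| = O(eps^(1/p)). Hence |s| <= |x*| + O(eps^(1/p)), and since
   the midpoint of s and x* is a minimizer of f, hence of norm at least |x*|, the
   parallelogram law yields |s - x*|^2 <= 2 (|s|^2 - |x*|^2) = O(eps^(1/p)). *)

(** * The parallelogram law and existence of minimizers *)

Section hilbert.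
Context {R : realType} {H : completeNormedModType R}.

Lemma the_elementE (A : set H) x : A = [set x] -> the_element A = x.
Proof.
move=> A1; apply: xget_unique => // y; rewrite A1 => xy.
by have : [set x] x by []; rewrite [in X in X -> _]xy.
Qed.

Lemma parallelogram (dot : {dot H for idfun}) (Hdot : induces_norm dot)
    (x y : H) : `|x + y| ^+ 2 + `|x - y| ^+ 2 = 2 * (`|x| ^+ 2 + `|y| ^+ 2).
Proof.
rewrite !Hdot !(linearDl, linearDr, linearNl, linearNr) opprK /=; ring.
Qed.

(** This form of the parallelogram law serves twice: as strong midpoint convexity of the squared
    norm, and to bound the distance between two minimizers of [f] in the theorem. *)
Lemma sqr_norm_midpoint (dot : {dot H for idfun}) (Hdot : induces_norm dot)
    (x y : H) :
  `|2^-1 *: (x + y)| ^+ 2 =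
  2^-1 * (`|x| ^+ 2 + `|y| ^+ 2) - 4^-1 * `|x - y| ^+ 2.
Proof.
rewrite normrZ exprMn ger0_norm ?invr_ge0 //.
have -> : `|x + y| ^+ 2 = 2 * (`|x| ^+ 2 + `|y| ^+ 2) - `|x - y| ^+ 2.
  by rewrite -(parallelogram Hdot) addrK.
by field.
Qed.

(* The strong midpoint convexity makes the sublevel sets of near-minimizers
   shrink in diameter, so they generate a Cauchy filter; by lower
   semicontinuity its limit is the minimizer. *)
Lemma unique_minimizer (g : H -> \bar R) (c : R) : 0 < c ->
  lower_semicontinuous g -> (exists m : R, forall x, (m%:E <= g x)%E) ->
  (exists x, g x != +oo%E) ->
  (forall x y a b, (g x <= a%:E)%E -> (g y <= b%:E)%E ->
     (g (2^-1 *: (x + y)) <= (2^-1 * (a + b) - c * `|x - y| ^+ 2)%:E)%E) ->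
  exists x, argmin g = [set x].
Proof.
move=> c0 glsc [m gm] [x0 gx0] gmid.
have Ifin : ereal_inf (range g) \is a fin_num.
  rewrite fin_numElt; apply/andP; split.
    apply: (@lt_le_trans _ _ m%:E); first exact: ltNyr.
    by apply: le_ereal_inf_tmp => _ [x _ <-].
  apply: (@le_lt_trans _ _ (g x0)); last by rewrite ltey.
  by apply: ereal_inf_lbound; exists x0.
set I := fine (ereal_inf (range g)).
have Ig x : (I%:E <= g x)%E.
  by rewrite fineK//; apply: ereal_inf_lbound; exists x.
pose B (e : R) := [set x | (g x <= (I + e)%:E)%E].
(* The midpoint of two points of [B e] has value at least [I], so the strong convexity term is at
   most [e]. *)
have Bdiam e x y : B e x -> B e y -> c * `|x - y| ^+ 2 <= e.
  move=> Bx By; have := le_trans (Ig _) (gmid _ _ _ _ Bx By).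
  by rewrite lee_fin; lra.
have BI e : 0 < e -> B e !=set0.
  move=> e0; have [_ [x _ <-]] := lb_ereal_inf_adherent e0 Ifin.
  by rewrite -(fineK Ifin) -EFinD => /ltW; exists x.
pose F := filter_from [set e : R | 0 < e] B.
have FF : ProperFilter F.
  apply: filter_from_proper; last by move=> e; exact: BI.
  apply: filter_from_filter; first by exists 1 => /=.
  move=> i j /= i0 j0; exists (Num.min i j); first by rewrite /= lt_min i0.
  move=> x Bx; split; apply: (le_trans Bx); rewrite lee_fin lerD2l.
    by rewrite ge_min lexx.
  by rewrite ge_min lexx orbT.
have Fcvg : cvg F.
  apply: cauchy_cvg; apply: cauchy_exP => e e0.
  (* This level bounds squared distances by [e ^+ 2 / 2], which leaves room for the strict
     inequality of the open ball. *)
  have d0 : 0 < c * e ^+ 2 / 2 by rewrite divr_gt0 // mulr_gt0 ?exprn_gt0.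
  have [x Bx] := BI _ d0.
  exists x; exists (c * e ^+ 2 / 2) => //= y By.
  rewrite -ball_normE /=; have := Bdiam _ _ _ Bx By.
  rewrite -mulrA ler_pM2l // => h.
  rewrite -(@ltr_pXn2r _ 2) ?nnegrE ?(ltW e0) //.
  by have := exprn_gt0 2 e0; lra.
set l := lim F.
have gl : (g l <= I%:E)%E.
  apply/lee_addgt0Pr => e e0; rewrite -EFinD leNgt; apply/negP.
  (* If [g l] exceeded [I + e], so would [g] on a neighbourhood [V] of [l]; but [V] contains some
     [B d], hence points of value at most [I + e]. *)
  move=> /glsc [V /Fcvg [d /= d0 BV] Vg].
  have [|x Bx] := BI (Num.min d e); first by rewrite lt_min d0.
  have /BV/Vg : B d x by apply: (le_trans Bx); rewrite lee_fin lerD2l ge_min lexx.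
  apply/negP; rewrite -leNgt; apply: (le_trans Bx).
  by rewrite lee_fin lerD2l ge_min lexx orbT.
exists l; apply/seteqP; split => [x gx|_ -> y]; last exact: le_trans (Ig y).
(* At level 0 the diameter bound forces any minimizer to coincide with [l]. *)
have B0 y : (g y <= I%:E)%E -> B 0 y by rewrite /B /= addr0.
have := Bdiam _ _ _ (B0 _ (le_trans (gx l) gl)) (B0 _ gl).
rewrite pmulr_rle0 // => xl; apply/eqP; rewrite -subr_eq0 -normr_eq0.
by rewrite -sqrf_eq0 eq_le xl sqr_ge0.
Qed.

End hilbert.

(** A real [b] strictly between [a - q x] and [f x] splits the slack: near [x], [f] stays above [b]
    and [q] above [a - b]. *)
Lemma lower_semicontinuousD_real (R : realType) (X : topologicalType)
    (f : X -> \bar R) (q : X -> R) :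
  lower_semicontinuous f -> continuous q ->
  lower_semicontinuous (fun x => f x + (q x)%:E)%E.
Proof.
move=> flsc qc x a axf.
have [b ab bf] : exists2 b : R, a - q x < b & (b%:E < f x)%E.
  move: axf; case: (f x) => [r| |] //.
    rewrite -EFinD lte_fin -ltrBlDr => axr.
    exists ((a - q x + r) / 2); rewrite ?lte_fin; lra.
  by exists (a - q x + 1); rewrite ?ltry//; lra.
have [V Vx Vf] := flsc _ _ bf.
have qx : \forall y \near x, a - b < q y.
  by have := qc x; move/cvgr_gt; apply; lra.
exists (V `&` [set y | a - b < q y]); first exact: filterI.
move=> y [/Vf bfy /= aby].
apply: (@le_lt_trans _ _ (b%:E + (a - b)%:E)%E).
  by rewrite -EFinD lee_fin; lra.
by apply: lteD => //; rewrite lte_fin.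
Qed.

(** The regularizer supplies the modulus [eps / 8], that is [eps / 2] times the [4^-1] of the
    parallelogram law. Real bounds [a] and [b] keep infinite values out of the convexity estimate.
    It is applied both to [f] and to an indicator function. *)
Lemma tikhonov_unique_minimizer (R : realType) (H : completeNormedModType R)
    (dot : {dot H for idfun}) (F : H -> \bar R) (eps : R) :
  induces_norm dot -> 0 < eps -> lower_semicontinuous F ->
  (exists m : R, forall x, (m%:E <= F x)%E) -> (exists x, F x != +oo%E) ->
  (forall x y a b, (F x <= a%:E)%E -> (F y <= b%:E)%E ->
     (F (2^-1 *: (x + y)) <= (2^-1 * (a + b))%:E)%E) ->
  exists x, argmin (tikhonov F eps) = [set x].
Proof.
move=> Hdot eps0 Flsc [m Fm] [x0 Fx0] Fmid.
apply: (@unique_minimizer _ _ _ (eps / 8)); first by lra.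
- apply: lower_semicontinuousD_real => // x.
  by apply: cvgM; [exact: cvg_cst|apply: cvgM; exact: cvg_norm].
- exists m => x; apply: le_trans (Fm x) _.
  by rewrite leeDl // lee_fin mulr_ge0 ?sqr_ge0 //; lra.
- by exists x0; rewrite /tikhonov; case: (F x0) Fx0.
move=> x y a b; rewrite /tikhonov -!leeBrDr // => xa yb.
have := Fmid _ _ _ _ xa yb; move=> /le_trans; apply.
by rewrite -EFinB lee_fin (sqr_norm_midpoint Hdot); lra.
Qed.

(** * Minimizers of a convex function and the projection of the origin *)

Section argmin.
Context {R : realType} {H : completeNormedModType R}.

Lemma midpoint_convex (f : H -> \bar R) : econvex_function f ->
  forall x y a b, (f x <= a%:E)%E -> (f y <= b%:E)%E ->
    (f (2^-1 *: (x + y)) <= (2^-1 * (a + b))%:E)%E.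
Proof.
move=> fconv x y a b fa fb.
have h : 0 <= (2^-1 : R) <= 1 by apply/andP; split; lra.
have := fconv x y 2^-1 h.
have -> : 1 - 2^-1 = 2^-1 :> R by field.
rewrite -scalerDr => /le_trans; apply.
by rewrite mulrDr EFinD !EFinM; apply: leeD; apply: lee_wpmul2l;
  rewrite // lee_fin; lra.
Qed.

Lemma argmin_fin_num (f : H -> \bar R) z :
  proper_function f -> argmin f z -> f z \is a fin_num.
Proof.
move=> [fNy [y fy]] fz; rewrite fin_numE fNy /=.
by apply: contra fy => /eqP fzy; rewrite -leye_eq -fzy.
Qed.

Lemma argmin_midpoint (f : H -> \bar R) (x y : H) : proper_function f ->
  econvex_function f -> argmin f x -> argmin f y ->
  argmin f (2^-1 *: (x + y)).
Proof.
move=> fproper fconv fx fy z; apply: le_trans (fx z).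
have fxE := fineK (argmin_fin_num fproper fx).
rewrite -fxE (_ : fine (f x) = 2^-1 * (fine (f x) + fine (f x))); last by field.
by apply: (midpoint_convex fconv); rewrite fxE.
Qed.

Lemma minval_argmin (f : H -> \bar R) z : argmin f z -> minval f = f z.
Proof.
move=> fz; apply/eqP; rewrite eq_le; apply/andP; split.
  by apply: ereal_inf_lbound; exists z.
by apply: le_ereal_inf_tmp => _ [y _ <-].
Qed.

(** If [x] in the closure were not minimal, lower semicontinuity would keep [f] above its minimum on
    a neighbourhood of [x], which nevertheless meets [argmin f]. *)
Lemma closed_argmin (f : H -> \bar R) : proper_function f ->
  lower_semicontinuous f -> closed (argmin f).
Proof.
move=> fproper flsc x clx y; rewrite leNgt; apply/negP => fyx.
have [z [fz _]] := clx _ (@filterT _ _ _).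
have fzE := fineK (argmin_fin_num fproper fz).
have [|V Vx Vf] := flsc x (fine (f z)).
  by rewrite fzE; exact: le_lt_trans fyx.
have [u [fu /Vf]] := clx _ Vx.
by rewrite fzE ltNge fu.
Qed.

(** Since [metric_proj] defaults to 0 unless the nearest point is unique, its defining property has
    to be earned by existence and uniqueness. *)
Lemma metric_proj0_unique (dot : {dot H for idfun}) (A : set H) :
  induces_norm dot -> closed A -> A !=set0 ->
  (forall x y, A x -> A y -> A (2^-1 *: (x + y))) ->
  A (metric_proj A 0) /\ forall q, A q -> `|metric_proj A 0| <= `|q|.
Proof.
move=> Hdot Acl [a Aa] Amid.
(* Projecting 0 on A amounts to minimizing the regularized indicator of A. *)
pose F x : \bar R := if x \in A then 0%E else +oo%E.
have FA x : A x -> F x = 0%E by move=> Ax; rewrite /F mem_set.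
have FNA x : ~ A x -> F x = +oo%E by move=> Ax; rewrite /F memNset.
have FP x b : (F x <= b%:E)%E -> A x /\ 0 <= b.
  by have [Ax|/FNA->//] := pselect (A x); rewrite FA // lee_fin.
(* With parameter 2 the regularizer is exactly the squared norm. *)
have [||||p pE] := @tikhonov_unique_minimizer _ _ dot F 2 Hdot (ltr0n _ 2).
- move=> x r rF; have [Ax|NAx] := pselect (A x).
    exists setT => [|y _]; first exact: filterT.
    apply: lt_le_trans rF _; rewrite FA //.
    by rewrite /F; case: ifP.
  exists (~` A) => [|y /FNA ->]; last exact: ltry.
  by apply: open_nbhs_nbhs; split => //; exact: closed_openC.
- by exists 0 => x; rewrite /F; case: ifP => _; rewrite ?lexx ?leey.
- by exists a; rewrite FA.
- move=> x y b c /FP[Ax b0] /FP[Ay c0]; rewrite FA ?lee_fin //; last exact: Amid.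
  by lra.
have TA x : A x -> tikhonov F 2 x = (`|x| ^+ 2)%:E.
  by move=> Ax; rewrite /tikhonov FA // add0e divff // mul1r.
have pmin : argmin (tikhonov F 2) p by rewrite pE.
have Ap : A p.
  apply: contrapT => NAp; have := pmin a.
  by rewrite (TA a) // /tikhonov FNA //= leye_eq.
have normE x y : A x -> A y ->
    (tikhonov F 2 x <= tikhonov F 2 y)%E = (`|x| <= `|y|).
  by move=> Ax Ay; rewrite !TA // lee_fin ler_sqr ?nnegrE.
have -> : metric_proj A 0 = p.
  apply: the_elementE; rewrite -pE; apply/seteqP; split => x /=.
    move=> [Ax xmin] y; apply: le_trans (pmin y); rewrite normE //.
    by have := xmin _ Ap; rewrite !sub0r !normrN.
  rewrite pE => ->; split => // q Aq; rewrite !sub0r !normrN -normE //.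
by split => // q Aq; rewrite -normE.
Qed.

End argmin.

(** * The convergence rate of the Tikhonov minimizers *)

Theorem proposition4p10 (R : realType) (H : completeNormedModType R)
    (dot : {dot H for idfun}) (Hdot : induces_norm dot)
    (f : H -> \bar R) (f_proper : proper_function f)
    (f_lsc : lower_semicontinuous f) (f_convex : econvex_function f)
    (argmin_neq0 : argmin f !=set0)
    (p : R) (p_ge1 : 1 <= p) (f_EB : EB p (argmin f) f) :
  let x_star : H := metric_proj (argmin f) 0 in
  let x_ : R -> H := tikhonov_min f in
  exists C0 eps_star : R, [/\ 0 < C0, 0 < eps_star,
    forall eps : R, 0 < eps <= eps_star ->
      `|x_ eps - x_star| <= C0 * eps `^ (1 / (2 * p)) &
    exists2 C : R, 0 < C &
      forall eps : R, 0 < eps <= eps_star ->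
        `|x_star| ^+ 2 - `|x_ eps| ^+ 2 <= C * eps `^ (1 / (2 * p))].
Proof.
move=> xs x_.
have [z fz] := argmin_neq0.
have fzE := fineK (argmin_fin_num f_proper fz).
set m := fine (f z) in fzE.
have minE : minval f = m%:E by rewrite (minval_argmin fz) fzE.
have fm x : (m%:E <= f x)%E by rewrite fzE.
have Smid x y : argmin f x -> argmin f y -> argmin f (2^-1 *: (x + y)).
  exact: argmin_midpoint.
have [Sxs xsmin] :=
  metric_proj0_unique Hdot (closed_argmin f_proper f_lsc) argmin_neq0 Smid.
rewrite -/xs in Sxs xsmin.
have [gamma [r [gamma0]]] := f_EB; rewrite minE lte_fin => mr EBf.
set N := `|xs| in xsmin *.
have N0 : 0 <= N by exact: normr_ge0.
have p0 : 0 < p by lra.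
(* Chosen so that [gamma * (M * eps)] is [(N ^+ 2 + 1) * eps], strictly more than the bound
   [eps / 2 * N ^+ 2] on [f (x_ eps) - m], even if [N] is 0. *)
pose M := (N ^+ 2 + 1) / gamma.
have N2 : 0 <= N ^+ 2 by exact: sqr_ge0.
have M0 : 0 < M by rewrite divr_gt0 //; lra.
pose K := M `^ p^-1.
have K0 : 0 < K by exact: powR_gt0.
(* With [t] the target rate and [t <= 1], [2 * ((N + K * t ^+ 2) ^+ 2 - N ^+ 2)] is at most
   [L ^+ 2 * t ^+ 2]. *)
pose L := Num.sqrt (4 * N * K + 2 * K ^+ 2).
have L0 : 0 <= L by exact: sqrtr_ge0.
have NK0 : 0 <= N * K by rewrite mulr_ge0 // ltW.
have L2 : L ^+ 2 = 4 * N * K + 2 * K ^+ 2.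
  by rewrite sqr_sqrtr //; have := sqr_ge0 K; lra.
(* The first bound gives [t <= 1]; the second puts [x_ eps] in the sublevel set [f <= r] where the
   error bound holds. *)
pose e0 := Num.min 1 ((r - m) / (N ^+ 2 + 1)).
have main eps : 0 < eps <= e0 ->
    `|x_ eps| <= N /\ `|x_ eps - xs| <= (K + L) * eps `^ (1 / (2 * p)).
  move=> /andP[eps0]; rewrite le_min ler_pdivlMr; last by lra.
  move=> /andP[eps1 epsr].
  have [||x xE] := tikhonov_unique_minimizer Hdot eps0 f_lsc _ _
    (midpoint_convex f_convex).
  - by exists m.
  - by exists z; rewrite -fzE.
  have -> : x_ eps = x by exact: the_elementE.
  have : argmin (tikhonov f eps) x by rewrite xE.
  move=> /(_ xs); rewrite /tikhonov -(minval_argmin Sxs) minE.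
  case fxE : (f x) (fm x) => [a| |] //; rewrite -!EFinD !lee_fin => ma xmin.
  have x2 : `|x| ^+ 2 <= N ^+ 2.
    rewrite -(@ler_pM2l _ (eps / 2)); last by lra.
    by rewrite /N; lra.
  have xN : `|x| <= N by rewrite -ler_sqr ?nnegrE.
  have epsx0 : 0 <= eps / 2 * `|x| ^+ 2.
    by rewrite mulr_ge0 ?sqr_ge0 //; lra.
  split=> //.
  set t := eps `^ (1 / (2 * p)).
  have t0 : 0 < t by exact: powR_gt0.
  have t1 : t <= 1.
    by rewrite -(powRr0 eps); apply: ger_powR; [rewrite eps0|rewrite divr_ge0//; lra].
  have tp : (K * t ^+ 2) `^ p = M * eps.
    have -> : t ^+ 2 = eps `^ p^-1.
      rewrite -powR_mulrn ?ltW // -powRrM; congr (_ `^ _).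
      by field; rewrite gt_eqF.
    rewrite powRM ?powR_ge0 // -!powRrM mulVf ?gt_eqF //.
    by rewrite !powRr1 // ltW.
  have Kt0 : 0 < K * t ^+ 2 by rewrite mulr_gt0 ?exprn_gt0.
  (* Strictness matters: it yields an actual minimizer [s] within [K * t ^+ 2] of [x]. *)
  have dist_lt : (edist_inf (argmin f) x < (K * t ^+ 2)%:E)%E.
    rewrite ltNge; apply/negP => h.
    have := EBf x; rewrite fxE lee_fin => /(_ ma).
    rewrite lee_fin -EFinB => /(_ _)/wrap[|EBx].
      by move: epsr x2; rewrite /N; nra.
    have : ((gamma * (M * eps))%:E <= (a - m)%:E)%E.
      apply: le_trans EBx; rewrite EFinM; apply: lee_wpmul2l.
        by rewrite lee_fin ltW.
      rewrite -tp -poweR_EFin; apply: gt0_ler_poweR => //; first exact: ltW.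
        by rewrite in_itv /= leey lee_fin ltW.
      by rewrite in_itv /= leey edist_inf_ge0.
    rewrite lee_fin mulrA (mulrC gamma) divfK ?gt_eqF //.
    have : 0 <= eps * N ^+ 2 by rewrite mulr_ge0 // ltW.
    by move: xmin; rewrite -/N; lra.
  have [_ [s Ss <-] /edist_lt_ball] := ereal_inf_lt dist_lt.
  rewrite -ball_normE /= => xs_lt.
  have sN : `|s| <= N + K * t ^+ 2.
    have := ler_normB x (x - s); rewrite opprB addrCA subrr addr0.
    by lra.
  have sxs : `|s - xs| ^+ 2 <= 2 * (`|s| ^+ 2 - N ^+ 2).
    have := xsmin _ (Smid _ _ Ss Sxs).
    rewrite -ler_sqr ?nnegrE // (sqr_norm_midpoint Hdot) -/N.
    by lra.
  have sL : `|s - xs| <= L * t.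
    rewrite -ler_sqr ?nnegrE ?mulr_ge0 // ?(ltW t0) //.
    apply: le_trans sxs _; rewrite exprMn L2.
    have s2 : `|s| ^+ 2 <= (N + K * t ^+ 2) ^+ 2.
      by rewrite ler_sqr ?nnegrE // addr_ge0 // ltW.
    have t4 : (K * t ^+ 2) ^+ 2 <= K ^+ 2 * t ^+ 2.
      rewrite exprMn ler_wpM2l ?sqr_ge0 // -exprM.
      by rewrite ler_wiXn2l // ltW.
    by move: s2; rewrite sqrrD; lra.
  (* The distance from [x] to [s] is of the better order [t ^+ 2], absorbed into [t]; the rate is
     set by the distance from [s] to [xs]. *)
  have t2 : K * t ^+ 2 <= K * t.
    by rewrite ler_pM2l // expr2 ler_piMl // ltW.
  have := ler_distD s x xs.
  lra.
exists (K + L), e0; split; first by lra.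
- by rewrite lt_min ltr01 divr_gt0 //; lra.
- by move=> eps /main[].
(* In the difference of squares, one factor is at most [(K + L) * t] and the other at most [2 * N];
   the added 1 keeps the constant positive when [N] is 0. *)
exists (2 * N * (K + L) + 1) => [|eps eh].
  by have := mulr_ge0 N0 (ltW (ltr_wpDr L0 K0)); lra.
have [xN xd] := main _ eh.
set t := eps `^ _ in xd *.
have t0 : 0 <= t by exact: powR_ge0.
have NxE : N - `|x_ eps| <= `|x_ eps - xs|.
  by rewrite distrC; exact: lerB_dist.
rewrite subr_sqr.
have : (N - `|x_ eps|) * (N + `|x_ eps|) <= ((K + L) * t) * (2 * N).
  apply: ler_pM; rewrite ?subr_ge0 ?addr_ge0 //; lra.
rewrite -/N; lra.
Qed.
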